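(* Let $G$ be a finite group with $|G|\ge3$. (1) For every $k\in\mathbb N$, $\mathcal U_k(G)$ is a finite interval of integers. (2) If $G$ satisfies Property P, then $\Delta(G)$ is a finite interval of integers with $\min\Delta(G)=1$.
   Context: For a finite group $G$ (multiplicative, identity $1_G$), $\mathcal F(G)$ is the free abelian monoid with basis $G$ (sequences $S=g_1\boldsymbol{\cdot}\ldots\boldsymbol{\cdot}g_\ell$, operation $\boldsymbol{\cdot}$). $\pi(S)=\{g_{\tau(1)}\cdots g_{\tau(\ell)}:\tau\text{ a permutation of }[1,\ell]\}$, $\mathcal B(G)=\{S\in\mathcal F(G):1_G\in\pi(S)\}$, $\mathcal A(G)$ its set of atoms. For $A\in\mathcal B(G)$, $\mathsf L(A)=\{k\in\mathbb N: A \text{ is a product of } k \text{ atoms}\}$ ($\mathsf L(1_{\mathcal F(G)})=\{0\}$), and $\mathcal L(G)=\{\mathsf L(A):A\in\mathcal B(G)\}$. For $k\in\mathbb N$, $\mathcal U_k(G)=\bigcup_{L\in\mathcal L(G),\,k\in L}L$. For a finite $L=\{m_1<\dots<m_r\}\subset\mathbb Z$, $\Delta(L)=\{m_i-m_{i-1}:i\in[2,r]\}$, and $\Delta(G)=\bigcup_{L\in\mathcal L(G)}\Delta(L)$. $G$ satisfies Property P if: whenever $U=g_1\boldsymbol{\cdot}\ldots\boldsymbol{\cdot}g_\ell\in\mathcal A(G)$ and $g_1=h_1h_2$ with $h_1,h_2\in G$, the sequence $h_1\boldsymbol{\cdot}h_2\boldsymbol{\cdot}g_2\boldsymbol{\cdot}\ldots\boldsymbol{\cdot}g_\ell$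 is either an atom or a product of two atoms of $\mathcal B(G)$. *)

(* Defs.v *)
(* Sequences over G (elements of the free abelian monoid F(G))
   are represented by lists [seq gT], identified up to permutation ([perm_eq]). *)
From HB Require Import structures.
From mathcomp Require Import all_boot all_order all_fingroup.
Set Implicit Arguments. Unset Strict Implicit. Unset Printing Implicit Defensive.
Local Open Scope group_scope.

Section Defs.
Variable gT : finGroupType.

Definition zero_sum (S : seq gT) : bool :=
  has (fun t : seq gT => \prod_(x <- t) x == 1) (permutations S).

Definition inB (S : seq gT) : Prop := zero_sum S.

Definition atom (U : seq gT) : Prop :=
  zero_sum U /\ U <> [::] /\
  forall S1 S2 : seq gT, perm_eq U (S1 ++ S2) -> zero_sum S1 -> zero_sum S2 ->
    S1 = [::] \/ S2 = [::].

Definition in_L (A : seq gT) (k : nat) : Prop :=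
  exists Us : seq (seq gT),
    size Us = k /\ (forall U, U \in Us -> atom U) /\ perm_eq A (flatten Us).

Definition in_Uk (k m : nat) : Prop :=
  exists A : seq gT, inB A /\ in_L A k /\ in_L A m.

Definition in_Delta (d : nat) : Prop :=
  exists A : seq gT, inB A /\ exists l m : nat,
    in_L A l /\ in_L A m /\ l < m /\ d = m - l /\
    (forall j, l < j < m -> ~ in_L A j).

Definition propertyP : Prop :=
  forall (U rest : seq gT) (g1 h1 h2 : gT),
    atom U -> perm_eq U (g1 :: rest) -> g1 = h1 * h2 ->
    atom [:: h1, h2 & rest] \/
    exists V1 V2 : seq gT, atom V1 /\ atom V2 /\ perm_eq [:: h1, h2 & rest] (V1 ++ V2).

End Defs.

Definition finite_interval (P : nat -> Prop) : Prop :=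
  exists a b : nat, forall m, P m <-> a <= m <= b.

(* Main.v *)
(** If A = U_1 ... U_k = V_1 ... V_l with k < l, some U_i, written as an ordered
    product equal to 1, has two consecutive letters g, h lying in different
    V's. Replacing them by the single letter gh keeps U_i an atom and fuses two
    of the V's into one product-one sequence, so the shorter sequence obtained
    still has length k, and has a length at least l - 1. Induction on |A| fills
    all integers between k and l in U_k; finiteness comes from the bound |G| on
    the size of atoms. Under Property P, splitting gh back shows that the gap
    after k shrinks by at most one, so Delta is closed downwards. Its
    boundedness follows from Dickson's lemma: a factorization that contains
    another one inherits the exchanges available for the latter. *)
Require Import Defs.
From HB Require Import structures.
From mathcomp Require Import all_boot all_order all_fingroup.
From mathcomp Require Import zify.
From Stdlib Require Import Classical.

Set Implicit Arguments.
Unset Strict Implicit.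
Unset Printing Implicit Defensive.

(** Permutation goals become linear arithmetic by comparing the counts of an arbitrary predicate. *)
Ltac perm_count :=
  let a := fresh "a" in
  apply/seq.permP => a;
  repeat match goal with
  | H : is_true (perm_eq _ _) |- _ => move/seq.permP/(_ a): H
  end;
  rewrite /= ?(flatten_cat, count_cat) /= ?(flatten_cat, count_cat) /=; lia.

(** * Intervals of natural numbers *)

Lemma ex_next_nat (P : nat -> Prop) k m :
  k < m -> P m ->
  exists2 n, k < n <= m & P n /\ forall j, k < j < n -> ~ P j.
Proof.
elim/ltn_ind: m => m IH lt_km Pm.
have [[j [/andP[kj jm] Pj]]|noj] := classic (exists j, k < j < m /\ P j).
  have [n /andP[kn nj] Hn] := IH j jm kj Pj.
  by exists n => //; rewrite kn (leq_trans nj (ltnW jm)).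
exists m; first by rewrite lt_km leqnn.
by split=> // j kjm Pj; apply: noj; exists j.
Qed.

Lemma ex_max_nat (P : nat -> Prop) k N :
  P k -> (forall m, P m -> m <= N) ->
  exists2 b, P b & forall m, P m -> m <= b.
Proof.
move=> Pk; elim: N => [|N IH] bound.
  exists k => // m Pm; by have := bound _ Pm; lia.
have [PN|nPN] := classic (P N.+1); first by exists N.+1.
apply: IH => m Pm; have := bound _ Pm; rewrite leq_eqVlt => /predU1P[mN|//].
by rewrite mN in Pm.
Qed.

Lemma ex_min_nat (P : nat -> Prop) k :
  P k -> exists2 a, P a & forall m, P m -> a <= m.
Proof.
elim/ltn_ind: k => k IH Pk.
have [[j [jk Pj]]|noj] := classic (exists j, j < k /\ P j); first exact: IH Pj.
exists k => // m Pm; rewrite leqNgt; apply/negP => mk; apply: noj; by exists m.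
Qed.

(** Convexity is asked only between the base point [k] and another element; used with the minimum
    and the maximum, it covers the whole range. *)
Lemma convex_finite_interval (P : nat -> Prop) k N :
  P k -> (forall m, P m -> m <= N) ->
  (forall i j, P j -> (k <= i <= j) || (j <= i <= k) -> P i) ->
  finite_interval P.
Proof.
move=> Pk bound conv.
have [b Pb maxb] := ex_max_nat Pk bound.
have [a Pa mina] := ex_min_nat Pk.
exists a, b => m; split=> [Pm|/andP[am mb]].
  by rewrite mina // maxb.
have [km|mk] := leqP k m; first by apply: (conv m b) => //; rewrite km mb.
by apply: (conv m a) => //; rewrite am (ltnW mk) orbT.
Qed.

(** * Dickson's lemma *)

Lemma dickson_basis (I X : eqType) (K : seq I) (f : X -> I -> nat)
    (P : X -> Prop) :
  exists2 B : seq X, (forall b, b \in B -> P b) &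
    forall x, P x -> exists2 b, b \in B & {in K, forall i, f b i <= f x i}.
Proof.
elim: K P => [|i K IH] P.
  have [[x Px]|noP] := classic (exists x, P x); last first.
    by exists [::] => // x Px; case: noP; exists x.
  exists [:: x] => [b|y _]; first by rewrite inE => /eqP->.
  by exists x; rewrite ?mem_head.
have [B BP Bdom] := IH P.
(* Elements with a large [i]-coordinate dominate [B]; the others are split
   into finitely many layers of constant [i]-coordinate. *)
have layers n : exists2 C : seq X, (forall b, b \in C -> P b) &
    forall x, P x -> f x i < n ->
      exists2 b, b \in C & {in i :: K, forall j, f b j <= f x j}.
  elim: n => [|n [C CP Cdom]]; first by exists [::].
  (* On the layer [f x i = n] only the coordinates in [K] remain to be compared, so the induction
     hypothesis applies to the restricted predicate. *)
  have [C' C'P C'dom] := IH (fun x => P x /\ f x i = n).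
  exists (C ++ C') => [b|x Px].
    by rewrite mem_cat => /orP[/CP //|/C'P[]].
  rewrite ltnS leq_eqVlt => /predU1P[fxi|fxi].
    have [b bC' bx] := C'dom x (conj Px fxi).
    exists b => [|j]; first by rewrite mem_cat bC' orbT.
    rewrite inE => /predU1P[->|/bx //].
    by have [_ ->] := C'P b bC'; rewrite fxi.
  have [b bC bx] := Cdom x Px fxi.
  by exists b; rewrite // mem_cat bC.
have [C CP Cdom] := layers (\max_(b <- B) f b i).
exists (B ++ C) => [b|x Px].
  by rewrite mem_cat => /orP[/BP|/CP].
have [large|small] := leqP (\max_(b <- B) f b i) (f x i).
  have [b bB bx] := Bdom x Px.
  exists b => [|j]; first by rewrite mem_cat bB.
  rewrite inE => /predU1P[->|/bx //].
  exact: leq_trans (leq_bigmax_seq _ bB isT) large.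
have [b bC bx] := Cdom x Px small.
by exists b; rewrite // mem_cat bC orbT.
Qed.

(** * Lists up to permutation *)

Lemma count_le_perm_cat (T : eqType) (s t : seq T) :
  {in s, forall x, count_mem x s <= count_mem x t} ->
  exists u, perm_eq t (s ++ u).
Proof.
move=> le_st.
have /count_subseqP[s' s't ss'] x : count_mem x s <= count_mem x t.
  have [/le_st //|] := boolP (x \in s).
  by move=> /count_memPn->.
have [u tu] := perm_to_subseq s't; exists u.
by rewrite (permPl tu) perm_cat2r perm_sym.
Qed.

(** Serves to carry block labels along a rearrangement of the letters. *)
Lemma perm_map_preim (S T : eqType) (f : S -> T) (s : seq T) (t : seq S) :
  perm_eq s (map f t) -> exists2 t', perm_eq t' t & s = map f t'.
Proof.
case: t => [/perm_nilP->|x t]; first by exists [::].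
case/(perm_iotaP (f x)) => Is; rewrite size_map => IsP ->.
exists (map (nth x (x :: t)) Is); last first.
  rewrite -map_comp; apply/eq_in_map => i.
  by rewrite (perm_mem IsP) mem_iota => /andP[_ lti]; rewrite [LHS](nth_map x).
by apply/(perm_iotaP x); exists Is.
Qed.

Lemma nonconstant_adjacent (T S : eqType) (f : T -> S) (s : seq T) :
  ~~ constant (map f s) ->
  exists p x y q, s = p ++ x :: y :: q /\ f x != f y.
Proof.
elim: s => [|x [|y s] IH] //=.
have [fxy|fxy] := eqVneq (f x) (f y); last first.
  by move=> _; exists [::], x, y, s.
move=> /= nc.
have [|p [x' [y' [q [-> ne]]]]] := IH; first by rewrite /= -fxy.
by exists (x :: p), x', y', q.
Qed.

(** Each constant block contributes at most one new value. *)
Lemma size_undup_flatten_constant (T : eqType) (ss : seq (seq T)) :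
  all constant ss -> size (undup (flatten ss)) <= size ss.
Proof.
elim: ss => [|s ss IH] //= /andP[cs /IH le].
suff : size (undup (s ++ flatten ss)) <= 1 + size (undup (flatten ss)) by lia.
case: s cs => [|x s] cs; first exact: leq_addl.
rewrite (@leq_trans (size (x :: undup (flatten ss)))) //.
apply: uniq_leq_size (undup_uniq _) _ => z.
rewrite mem_undup mem_cat !inE mem_undup.
by case: eqP => //= ne /orP[/(allP cs)/eqP|].
Qed.

(* Label every letter of [flatten Us] by the block of [Vs] it is matched with:
   there are more labels than blocks of [Us], so some block is not constant. *)
Lemma adjacent_letters_in_distinct_blocks (T : eqType) (Us Vs : seq (seq T)) :
  [::] \notin Vs -> perm_eq (flatten Us) (flatten Vs) -> size Us < size Vs ->
  exists p x y q a b,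
    [/\ p ++ x :: y :: q \in Us, a != b, a < size Vs /\ b < size Vs,
        x \in nth [::] Vs a & y \in nth [::] Vs b].
Proof.
move=> nVs UV ltUV.
pose L := flatten [seq [seq (v, i) | v <- nth [::] Vs i] | i <- iota 0 (size Vs)].
have fstL : map fst L = flatten Vs.
  rewrite map_flatten -map_comp -[in RHS](mkseq_nth [::] Vs); congr flatten.
  by apply: eq_map => i /=; rewrite -map_comp map_id.
have memL x i : (x, i) \in L -> i < size Vs /\ x \in nth [::] Vs i.
  by case/flatten_mapP=> j; rewrite mem_iota => lt /mapP[v vV [-> ->]].
rewrite -fstL in UV; have [M ML UM] := perm_map_preim UV.
(* [M] lists the labelled letters in the order of [flatten Us]; cutting it to the shape of [Us]
   labels each block letter by letter. *)
pose Ms := reshape (shape Us) M.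
have szM : size M = sumn (shape Us) by rewrite -size_flatten UM size_map.
have flM : flatten Ms = M by rewrite reshapeKr // szM.
have mapMs : map (map fst) Ms = Us by rewrite map_reshape -UM flattenK.
have szMs : size Ms = size Us by rewrite -mapMs size_map.
have /allPn[l] : ~~ all constant (map (map snd) Ms).
  apply/negP => /size_undup_flatten_constant.
  rewrite size_map szMs -map_flatten flM => le.
  suff : size (iota 0 (size Vs)) <= size (undup (map snd M)).
    by rewrite size_iota; lia.
  apply: uniq_leq_size (iota_uniq _ _) _ => i.
  rewrite mem_undup mem_iota /= add0n => lti.
  case Vi : (nth [::] Vs i) => [|v V].
    by case/negP: nVs; rewrite -Vi mem_nth.
  apply/mapP; exists (v, i) => //; rewrite (perm_mem ML).
  apply/flatten_mapP; exists i; first by rewrite mem_iota.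
  by rewrite Vi mem_head.
case/mapP=> m mMs -> /nonconstant_adjacent[p [[x a] [[y b] [q [mE ab]]]]].
have inL z : z \in m -> z \in L.
  by move=> zm; rewrite -(perm_mem ML) -flM; apply/flattenP; exists m.
have [lta xa] : a < size Vs /\ x \in nth [::] Vs a.
  by apply/memL/inL; rewrite mE mem_cat !inE eqxx orbT.
have [ltb yb] : b < size Vs /\ y \in nth [::] Vs b.
  by apply/memL/inL; rewrite mE mem_cat !inE eqxx !orbT.
exists (map fst p), x, y, (map fst q), a, b; split=> //.
by rewrite -mapMs; apply/mapP; exists m => //; rewrite mE map_cat.
Qed.

(** Working with indices keeps apart two positions that may hold equal entries. *)
Lemma perm_two_nth (T : eqType) (x0 : T) (s : seq T) a b :
  a != b -> a < size s -> b < size s ->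
  exists u, perm_eq s [:: nth x0 s a, nth x0 s b & u].
Proof.
move=> ab lta ltb.
have sE : perm_eq s [seq nth x0 s i | i <- iota 0 (size s)].
  by rewrite -/(mkseq _ _) mkseq_nth.
have aI : a \in iota 0 (size s) by rewrite mem_iota.
have bI : b \in rem a (iota 0 (size s)).
  by rewrite mem_rem_uniq ?iota_uniq // !inE eq_sym ab mem_iota.
exists [seq nth x0 s i | i <- rem b (rem a (iota 0 (size s)))].
rewrite (permPl sE) -2!map_cons perm_map //.
rewrite (permPl (perm_to_rem aI)) perm_cons; exact: perm_to_rem.
Qed.

(** * Product-one sequences and atoms *)

Section ProductOne.
Variable gT : finGroupType.
Implicit Types (S U V A : seq gT) (Us Vs : seq (seq gT)).

Lemma zero_sumP S :
  reflect (exists2 t, perm_eq t S & (\prod_(x <- t) x = 1)%g) (zero_sum S).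
Proof.
apply: (iffP hasP) => [[t]|[t tS t1]].
  by rewrite mem_permutations => tS /eqP; exists t.
by exists t; rewrite ?mem_permutations //; apply/eqP.
Qed.

Lemma perm_zero_sum S T : perm_eq S T -> zero_sum S = zero_sum T.
Proof.
move=> ST; apply/zero_sumP/zero_sumP=> -[t tS t1]; exists t => //.
  by rewrite (permPl tS).
by rewrite (permPl tS) perm_sym.
Qed.

Lemma zero_sum_cat S T : zero_sum S -> zero_sum T -> zero_sum (S ++ T).
Proof.
case/zero_sumP=> s sS s1 /zero_sumP[t tT t1]; apply/zero_sumP.
by exists (s ++ t); rewrite ?perm_cat // big_cat /= s1 t1 mulg1.
Qed.

(** If the product is 1, the two partial products are mutually inverse, hence commute. *)
Lemma prod_catC (s t : seq gT) :
  (\prod_(x <- s ++ t) x = 1 -> \prod_(x <- t ++ s) x = 1)%g.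
Proof.
rewrite !big_cat /= => /eqP; rewrite mulg_eq1 => /eqP->.
by rewrite mulgV.
Qed.

Lemma zero_sum_cons g S :
  zero_sum (g :: S) -> exists2 t, perm_eq t S & (g * \prod_(x <- t) x = 1)%g.
Proof.
case/zero_sumP=> t tS.
have gt : g \in t by rewrite (perm_mem tS) mem_head.
case/splitPr: t / gt tS => p q tS /prod_catC; rewrite big_cons => e.
by exists (q ++ p) => //; perm_count.
Qed.

Lemma zero_sum_split g h S : zero_sum ((g * h)%g :: S) -> zero_sum [:: g, h & S].
Proof.
case/zero_sum_cons=> t tS t1; apply/zero_sumP.
by exists [:: g, h & t]; rewrite ?perm_cons // !big_cons mulgA.
Qed.

(** The ordering [g], [h], [T], [S] works: [h] cancels against [T], then [g] against [S]. *)
Lemma zero_sum_join g h S T :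
  zero_sum (g :: S) -> zero_sum (h :: T) -> zero_sum ((g * h)%g :: S ++ T).
Proof.
case/zero_sum_cons=> s sS s1 /zero_sum_cons[t tT t1]; apply/zero_sumP.
exists ((g * h)%g :: t ++ s); first by perm_count.
by rewrite big_cons big_cat /= mulgA -(mulgA g) t1 mulg1.
Qed.

Lemma perm_atom U V : perm_eq U V -> atom U -> atom V.
Proof.
move=> UV [zU [nU irrU]]; split; first by rewrite -(perm_zero_sum UV).
split=> [V0|S1 S2 VS]; last by apply: irrU; rewrite (permPl UV).
by apply: nU; apply/perm_nilP; rewrite -V0.
Qed.

(** In a splitting of the merged sequence, the factor containing [g * h] stays product-one when that
    letter is split back, which gives a splitting of [U]. *)
Lemma atom_merge U p g h q :
  atom U -> perm_eq U (p ++ [:: g, h & q]) ->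
  (\prod_(x <- p ++ [:: g, h & q]) x = 1)%g -> atom ((g * h)%g :: p ++ q).
Proof.
move=> [_ [_ irrU]] UE prod1.
have head S1 S2 : perm_eq ((g * h)%g :: p ++ q) (S1 ++ S2) ->
    (g * h)%g \in S1 -> zero_sum S1 -> zero_sum S2 -> S2 = [::].
  move=> ES in1 z1 z2; have S1E := perm_to_rem in1.
  rewrite (perm_zero_sum S1E) in z1.
  case: (irrU [:: g, h & rem (g * h)%g S1] S2) => //; first by perm_count.
  exact: zero_sum_split.
split; last split=> // S1 S2 ES z1 z2.
  apply/zero_sumP; exists (p ++ (g * h)%g :: q); first by perm_count.
  by move: prod1; rewrite !big_cat /= !big_cons -mulgA.
have : (g * h)%g \in S1 ++ S2 by rewrite -(perm_mem ES) mem_head.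
rewrite mem_cat => /orP[in1|in2]; first by right; apply: head ES in1 z1 z2.
by left; apply: head in2 z2 z1; rewrite (permPl ES) perm_catC.
Qed.

(** * Sets of lengths *)

Lemma in_L_perm A B k : perm_eq A B -> in_L A k -> in_L B k.
Proof.
move=> AB [Us [szU [aU AU]]]; exists Us; split=> //; split=> //.
by rewrite -(permPl AB).
Qed.

Lemma in_L_cat A B k l : in_L A k -> in_L B l -> in_L (A ++ B) (k + l).
Proof.
move=> [Us [<- [aU AU]]] [Vs [<- [aV BV]]]; exists (Us ++ Vs).
split; first by rewrite size_cat.
split=> [W|]; first by rewrite mem_cat => /orP[/aU|/aV].
by rewrite flatten_cat perm_cat.
Qed.

Lemma in_L_flatten Us : (forall U, U \in Us -> atom U) -> in_L (flatten Us) (size Us).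
Proof. by exists Us. Qed.

Lemma in_L_atom U : atom U -> in_L U 1.
Proof.
by move=> aU; exists [:: U]; split=> //; split=> [V|/=];
  rewrite ?cats0 // inE => /eqP->.
Qed.

Lemma in_L_zero_sum A k : in_L A k -> zero_sum A.
Proof.
case=> Us [_ [aU AU]]; rewrite (perm_zero_sum AU); elim: Us aU {AU} => [|U Us IH] aU.
  by apply/zero_sumP; exists [::]; rewrite ?big_nil.
rewrite zero_sum_cat //; first by have [] := aU U (mem_head _ _).
by apply: IH => V VUs; apply: aU; rewrite inE VUs orbT.
Qed.

Lemma zero_sum_in_L S : zero_sum S -> exists k, in_L S k.
Proof.
have [n] := ubnP (size S); elim: n S => // n IH S ltS zS.
have [-> |nS] := eqVneq S [::]; first by exists 0, [::].
have [aS|naS] := classic (atom S); first by exists 1; apply: in_L_atom.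
have [S1 [S2 [SE [z1 [z2 [n1 n2]]]]]] : exists S1 S2, perm_eq S (S1 ++ S2) /\
    zero_sum S1 /\ zero_sum S2 /\ S1 <> [::] /\ S2 <> [::].
  apply: NNPP => no; apply: naS; split=> //; split; first exact/eqP.
  move=> S1 S2 SE z1 z2; apply: NNPP => /not_or_and[n1 n2].
  by apply: no; exists S1, S2.
have sz : size S = size S1 + size S2 by rewrite (perm_size SE) size_cat.
have s1 : 0 < size S1 by case: (S1) n1.
have s2 : 0 < size S2 by case: (S2) n2.
have [||k1 k1P] := IH S1; [lia|done|].
have [||k2 k2P] := IH S2; [lia|done|].
exists (k1 + k2); apply: in_L_perm (in_L_cat k1P k2P); by rewrite perm_sym.
Qed.

Lemma in_L0 A : in_L A 0 -> A = [::].
Proof. by case=> Us [/size0nil-> [_ /perm_nilP]]. Qed.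

Lemma atom_one : atom [:: 1%g : gT].
Proof.
split; first by apply/zero_sumP; exists [:: 1%g] => //; rewrite big_seq1.
split=> // S1 S2 /perm_size; rewrite size_cat /=.
by case: S1 => [|? []]; [left|case: S2 => // _ _ _; right|].
Qed.

Lemma in_L_ones n : in_L (nseq n (1%g : gT)) n.
Proof.
elim: n => [|n IH]; first by exists [::].
by rewrite -add1n nseqD; apply: in_L_cat => //; apply/in_L_atom/atom_one.
Qed.

(* Two of the [size U + 1] partial products of a long sequence coincide, which
   cuts out a proper product-one subword. *)
Lemma atom_size U : atom U -> size U <= #|gT|.
Proof.
move=> [/zero_sumP[t tU t1] [nU irrU]]; rewrite leqNgt; apply/negP => big.
have szt : size t = size U by rewrite (perm_size tU).
(* Indices stay below [size U], so the word cut out never reaches the last letter and its complement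
   is nonempty. *)
pose pp (i : 'I_(size U)) := (\prod_(x <- take i t) x)%g.
have /injectivePn[i [j]] : ~~ injectiveb pp.
  by apply/negP => /injectiveP/leq_card; rewrite card_ord leqNgt big.
wlog lt_ij : i j / i < j => [W ij e|_ e].
  have [/W|/W|/val_inj] := ltngtP i j; [exact|by apply; rewrite 1?eq_sym|].
  by move/eqP; rewrite (negbTE ij).
pose t1' := take i t; pose t2 := drop i (take j t); pose t3 := drop j t.
have tj : take j t = t1' ++ t2.
  by rewrite -[LHS](cat_take_drop i) take_takel // ltnW.
have tE : t = t1' ++ t2 ++ t3 by rewrite catA -tj cat_take_drop.
have p2 : (\prod_(x <- t2) x = 1)%g.
  by move: e; rewrite /pp tj big_cat /= -/t1' -{1}[LHS]mulg1 => /mulgI.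
case: (irrU t2 (t1' ++ t3)).
- by rewrite tE in tU; perm_count.
- by apply/zero_sumP; exists t2.
- apply/zero_sumP; exists (t1' ++ t3) => //.
  by move: t1; rewrite tE !big_cat /= p2 mul1g.
- move/(congr1 size); rewrite size_drop size_takel /=; last first.
    by rewrite szt ltnW.
  lia.
by move/(congr1 size); rewrite size_cat !size_drop szt /=; have := ltn_ord j; lia.
Qed.

(** * Merging adjacent letters *)

(** Each atom is relisted in an order whose product is 1, so that merging neighbours preserves this
    product. *)
Lemma order_factorization Us : (forall U, U \in Us -> atom U) ->
  exists Us', [/\ size Us' = size Us, perm_eq (flatten Us) (flatten Us') &
    forall U, U \in Us' -> atom U /\ (\prod_(x <- U) x = 1)%g].
Proof.
elim: Us => [|U Us IH] aU; first by exists [::].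
have [|Us' [sz UU' aU']] := IH; first by move=> V VUs; apply: aU; rewrite inE VUs orbT.
have aU0 := aU U (mem_head _ _); have [/zero_sumP[t tU t1] _] := aU0.
exists (t :: Us'); split=> [|/=|V]; first by rewrite /= sz.
  by perm_count.
rewrite inE => /predU1P[->|/aU' //]; split=> //.
by apply: perm_atom aU0; rewrite perm_sym.
Qed.

(* The new sequence is shorter, keeps the length [k], and loses at most one
   from the length [l]. *)
Lemma merge_factorizations A k l : in_L A k -> in_L A l -> k < l ->
  exists g h R, [/\ perm_eq A [:: g, h & R], in_L ((g * h)%g :: R) k &
    exists2 l', l <= l'.+1 & in_L ((g * h)%g :: R) l'].
Proof.
move=> [Us0 [<- [aU0 AU0]]] [Vs [<- [aV AV]]].
have [Us [<- UU aU]] := order_factorization aU0.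
have AU : perm_eq A (flatten Us) by rewrite (permPl AU0).
move=> {Us0 aU0 AU0 UU} ltUV.
have nVs : [::] \notin Vs by apply/negP => /aV[_ []].
have UV : perm_eq (flatten Us) (flatten Vs) by rewrite -(permPl AU).
have [p [g [h [q [a [b [inUs ab [lta ltb] ga hb]]]]]]] :=
  adjacent_letters_in_distinct_blocks nVs UV ltUV.
have [Ws VsE] := perm_two_nth [::] ab lta ltb.
have aVa : atom (nth [::] Vs a) by apply: aV; apply: mem_nth.
have aVb : atom (nth [::] Vs b) by apply: aV; apply: mem_nth.
move: (nth _ Vs a) (nth _ Vs b) ga hb VsE aVa aVb => Va Vb ga hb VsE aVa aVb.
have aWs W : W \in Ws -> atom W.
  by move=> WW; apply: aV; rewrite (perm_mem VsE) !inE WW !orbT.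
have VaE := perm_to_rem ga; have VbE := perm_to_rem hb.
have fVs := perm_flatten VsE.
have UsE := perm_to_rem inUs; have fUs := perm_flatten UsE.
pose R := p ++ q ++ flatten (rem (p ++ [:: g, h & q]) Us).
have RE : perm_eq R (rem g Va ++ rem h Vb ++ flatten Ws).
  by rewrite /R; perm_count.
exists g, h, R; split; first by rewrite /R; perm_count.
  rewrite (perm_size UsE) /= -add1n.
  have -> : (g * h)%g :: R =
     ((g * h)%g :: p ++ q) ++ flatten (rem (p ++ [:: g, h & q]) Us).
    by rewrite /R /= catA.
  apply: in_L_cat; last first.
    by apply: in_L_flatten => W /mem_rem /aU[].
  have [aE pE] := aU _ inUs; exact/in_L_atom/(atom_merge aE).
(* The fused block need not be an atom, but being nonempty it has a length [t >= 1]; at most one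
   factor is lost. *)
have /zero_sum_in_L[t tP] : zero_sum ((g * h)%g :: rem g Va ++ rem h Vb).
  apply: zero_sum_join; first by rewrite -(perm_zero_sum VaE); case: aVa.
  by rewrite -(perm_zero_sum VbE); case: aVb.
exists (t + size Ws).
  rewrite (perm_size VsE) /=; case: t tP => [/in_L0 //|t _]; lia.
apply: in_L_perm (in_L_cat tP (in_L_flatten aWs)).
by perm_count.
Qed.

(** * Unions of sets of lengths *)

Lemma in_Uk_between A k l i : in_L A k -> in_L A l -> k <= i <= l -> in_Uk gT k i.
Proof.
have [n] := ubnP (size A); elim: n A l => // n IH A l ltA Ak Al /andP[ki il].
have zA : inB A by apply: in_L_zero_sum Ak.
move: ki; rewrite leq_eqVlt => /predU1P[<-|ki]; first by exists A.
move: il; rewrite leq_eqVlt => /predU1P[->|il]; first by exists A.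
(* From [i < l <= l'.+1] it follows that [i <= l'], so [i] stays in range for the shorter
   sequence. *)
have [g [h [R [AE A'k [l' ll' A'l']]]]] :=
  merge_factorizations Ak Al (ltn_trans ki il).
apply: IH A'k A'l' _; first by move: ltA; rewrite (perm_size AE).
lia.
Qed.

Lemma in_UkC k l : in_Uk gT k l -> in_Uk gT l k.
Proof. by case=> A [zA [Ak Al]]; exists A. Qed.

(** Atoms have between 1 and [#|gT|] letters, so [size A] lies between [l] and [k * #|gT|]. *)
Lemma in_L_size_le A k l : in_L A k -> in_L A l -> l <= k * #|gT|.
Proof.
move=> [Us [<- [aU AU]]] [Vs [<- [aV AV]]].
have : size (flatten Vs) <= size (flatten Us).
  by rewrite -(perm_size AU) -(perm_size AV).
have : size Vs <= size (flatten Vs).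
  elim: Vs aV {AV} => //= V Vs IH aV; rewrite size_cat.
  have [_ [nV _]] := aV V (mem_head _ _).
  have : size Vs <= size (flatten Vs).
    by apply: IH => W WVs; apply: aV; rewrite inE WVs orbT.
  by case: V nV {aV} => //= *; lia.
have : size (flatten Us) <= size Us * #|gT|.
  elim: Us aU {AU} => //= U Us IH aU; rewrite size_cat mulSn leq_add //.
    by apply/atom_size/aU/mem_head.
  by apply: IH => W WUs; apply: aU; rewrite inE WUs orbT.
lia.
Qed.

Lemma in_Uk_finite_interval k : finite_interval (in_Uk gT k).
Proof.
apply: (@convex_finite_interval _ k (k * #|gT|)).
- exists (nseq k 1%g); split; last by split; apply: in_L_ones.
  exact: in_L_zero_sum (in_L_ones k).
- by move=> m [A [_ [Ak Am]]]; apply: in_L_size_le Ak Am.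
move=> i j [A [_ [Ak Aj]]] /orP[|/andP[ji ik]]; first exact: in_Uk_between Ak Aj.
(* Padding [A] with [i - j] identities gives the lengths [i] and [k + (i - j)]. Since [k] lies
   between them, it is in the union for [i]; symmetry concludes. *)
have Ones := in_L_ones (i - j).
have Bi := in_L_cat Aj Ones; rewrite subnKC // in Bi.
apply/in_UkC/(in_Uk_between Bi (in_L_cat Ak Ones)); lia.
Qed.

(** * Sets of distances *)

Definition adjacent_lengths A k l : Prop :=
  [/\ in_L A k, in_L A l, k < l & forall j, k < j < l -> ~ in_L A j].

Lemma adjacent_lengths_in_Delta A k l :
  adjacent_lengths A k l -> in_Delta gT (l - k).
Proof.
case=> Ak Al kl no; exists A; split; first exact: in_L_zero_sum Ak.
by exists k, l.
Qed.

(** Only the atom containing [g * h] changes, and Property P turns it into one or two atoms. *)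
Lemma in_L_split (g h : gT) R k : propertyP gT -> in_L ((g * h)%g :: R) k ->
  in_L [:: g, h & R] k \/ in_L [:: g, h & R] k.+1.
Proof.
move=> propP [Ws [<- [aW RW]]].
have /flattenP[W WWs ghW] : (g * h)%g \in flatten Ws.
  by rewrite -(perm_mem RW) mem_head.
have WsE := perm_to_rem WWs; have fWs := perm_flatten WsE.
have WE := perm_to_rem ghW.
have rest : in_L (flatten (rem W Ws)) (size (rem W Ws)).
  by apply: in_L_flatten => X /mem_rem /aW.
rewrite (perm_size WsE) /=.
case: (propP _ _ _ _ _ (aW _ WWs) WE erefl) => [aX|[V1 [V2 [a1 [a2 XE]]]]].
  left; rewrite -add1n; apply: in_L_perm (in_L_cat (in_L_atom aX) rest).
  by perm_count.
right; rewrite -[_.+2]/(1 + 1 + _).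
apply: in_L_perm (in_L_cat (in_L_cat (in_L_atom a1) (in_L_atom a2)) rest).
by perm_count.
Qed.

(* By Property P a length [r] of the merged sequence forces [r] or [r + 1] to
   be a length of [A], so the gap after [k] shrinks by at most one. *)
Lemma Delta_downward_closed A k l d : propertyP gT ->
  adjacent_lengths A k l -> 0 < d <= l - k -> in_Delta gT d.
Proof.
move=> propP; have [n] := ubnP (size A); elim: n A l => // n IH A l ltA adj dP.
have [->|ne] := eqVneq d (l - k); first exact: adjacent_lengths_in_Delta adj.
case: adj => Ak Al kl no.
have [g [h [R [AE A'k [l' ll' A'l']]]]] := merge_factorizations Ak Al kl.
have kl' : k < l' by lia.
have [m /andP[km _] [A'm no']] := ex_next_nat kl' A'l'.
apply: (IH ((g * h)%g :: R) m) => [||/=]; first by move: ltA; rewrite (perm_size AE).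
  by split.
(* Otherwise [m] and [m.+1] both lie strictly between [k] and [l], and one of them is a length of
   [A]. Hence [d < l - k] gives [d <= m - k]. *)
have lm : l <= m.+1.
  rewrite leqNgt; apply/negP => ml.
  by case: (in_L_split propP A'm) => Am; (apply: no; last first);
    [apply: in_L_perm Am; rewrite perm_sym| |apply: in_L_perm Am; rewrite perm_sym|];
    rewrite //; lia.
lia.
Qed.

(* Exchanging [Us] for [Vs] inside [Us'] produces a longer factorization, whose
   length must not fall into the gap above [size Us']. *)
Lemma adjacent_gap_le Us Vs Us' n :
  perm_eq (flatten Us) (flatten Vs) -> size Us < size Vs ->
  (forall V, V \in Vs -> atom V) -> (forall U, U \in Us' -> atom U) ->
  (forall j, size Us' < j < n -> ~ in_L (flatten Us') j) ->
  {in Us, forall U, count_mem U Us <= count_mem U Us'} ->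
  n - size Us' <= size Vs - size Us.
Proof.
move=> UV ltUV aV aU' no /count_le_perm_cat[Ws U'E].
rewrite leqNgt; apply/negP => gap.
have szU' : size Us' = size Us + size Ws by rewrite (perm_size U'E) size_cat.
have fU' := perm_flatten U'E.
apply: (no (size Vs + size Ws)); first by lia.
apply: in_L_perm (in_L_cat (in_L_flatten aV) (in_L_flatten (_ : forall W, W \in Ws -> _))).
  by perm_count.
by move=> W WW; apply: aU'; rewrite (perm_mem U'E) mem_cat WW orbT.
Qed.

(** Dickson's lemma is applied to pairs of factorizations of adjacent lengths, with the
    multiplicities of atoms in the shorter one as coordinates; the largest gap in the finite basis
    bounds all gaps. *)
Lemma Delta_bounded : exists N, forall d, in_Delta gT d -> d <= N.
Proof.
pose X : eqType := (seq (seq gT) * seq (seq gT))%type.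
pose P (x : X) :=
  [/\ forall U, U \in x.1 -> atom U, forall V, V \in x.2 -> atom V,
      perm_eq (flatten x.1) (flatten x.2), size x.1 < size x.2 &
      forall j, size x.1 < j < size x.2 -> ~ in_L (flatten x.1) j].
(* A finite list of coordinates that contains every atom, by [atom_size]. *)
pose K := [seq val b | b : #|gT|.-bseq gT].
have [B BP Bdom] := dickson_basis K (fun (x : X) U => count_mem U x.1) P.
exists (\max_(b <- B) (size b.2 - size b.1)).
move=> d [A [_ [l [m [[Us [<- [aU AU]]] [[Vs [<- [aV AV]]] [lt [-> no]]]]]]]].
have UV : perm_eq (flatten Us) (flatten Vs) by rewrite -(permPl AU).
have [|[Us0 Vs0] bB bx] := Bdom (Us, Vs).
  split=> //= j jP Lj; apply: (no j jP); apply: in_L_perm Lj.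
  by rewrite perm_sym.
apply: leq_trans (leq_bigmax_seq _ bB isT) => /=.
have [/= aU0 aV0 UV0 lt0 _] := BP _ bB.
apply: adjacent_gap_le UV0 lt0 aV0 aU _ _ => [j jP Lj|U UU0].
  by apply: (no j jP); apply: in_L_perm Lj; rewrite perm_sym.
apply: bx; apply/mapP; exists (Bseq (atom_size (aU0 _ UU0))) => //.
by rewrite mem_enum.
Qed.

(** * A sequence with lengths 2 and 3 *)

(** A proper splitting of at most three letters has a factor of one letter, which would have to be
    1. *)
Lemma small_atom U : zero_sum U -> U <> [::] -> (1%g : gT) \notin U ->
  size U <= 3 -> atom U.
Proof.
move=> zU nU U1 szU; split=> //; split=> // S1 S2 UE z1 z2.
have no1 S : zero_sum S -> {subset S <= U} -> size S != 1.
  case: S => [|x [|y S]] // /zero_sum_cons[t /perm_nilP->].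
  rewrite big_nil mulg1 => -> sub; case/negP: U1; apply: sub; exact: mem_head.
have /(no1 _ z1) : {subset S1 <= U}.
  by move=> x xS; rewrite (perm_mem UE) mem_cat xS.
have /(no1 _ z2) : {subset S2 <= U}.
  by move=> x xS; rewrite (perm_mem UE) mem_cat xS orbT.
have : size U = size S1 + size S2 by rewrite (perm_size UE) size_cat.
by case: S1 {UE z1} => [|? [|? S1]]; case: S2 {z2} => [|? [|? S2]];
  auto => /=; lia.
Qed.

Lemma atom_inv_pair (a : gT) : a != 1%g -> atom [:: a; a^-1]%g.
Proof.
move=> a1; apply: small_atom => //.
  by apply/zero_sumP; exists [:: a; a^-1]%g => //; rewrite !big_cons big_nil mulg1 mulgV.
by rewrite !inE ![1%g == _]eq_sym invg_eq1 negb_or a1.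
Qed.

Lemma atom_triple (a b c : gT) :
  (a * b * c = 1)%g -> a != 1%g -> b != 1%g -> c != 1%g -> atom [:: a; b; c].
Proof.
move=> abc a1 b1 c1; apply: small_atom => //.
  by apply/zero_sumP; exists [:: a; b; c] => //; rewrite !big_cons big_nil mulg1 mulgA.
by rewrite !inE ![1%g == _]eq_sym !negb_or a1 b1.
Qed.

(** Two triples [a, b, (a * b)^-1] and [b^-1, a^-1, a * b] regroup into three inverse pairs. *)
Lemma exists_lengths_2_3 : 3 <= #|gT| ->
  exists2 A : seq gT, in_L A 2 & in_L A 3.
Proof.
move=> hG.
have [a a1] : exists a : gT, a != 1%g.
  have : 0 < #|[set~ (1%g : gT)]| by rewrite cardsC1; case: #|_| hG => [|[]].
  by case/card_gt0P=> a; rewrite !inE; exists a.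
(* Avoiding [a^-1] makes [a * b] nontrivial; a third group element leaves room for this choice. *)
have [b] : exists b : gT, b \notin [set 1; a^-1]%g.
  have : 0 < #|~: [set 1; a^-1]%g|.
    by move: hG; rewrite -(cardsC [set 1; a^-1]%g) cards2; case: (_ != _); lia.
  by case/card_gt0P=> b; rewrite inE; exists b.
rewrite !inE negb_or => /andP[b1 ba].
have ab1 : (a * b)%g != 1%g.
  by apply: contra ba => /eqP e; rewrite eq_sym eq_invg_mul e.
exists ([:: a; b; (a * b)^-1] ++ [:: b^-1; a^-1; a * b])%g.
  apply: (@in_L_cat _ _ 1 1); apply/in_L_atom/atom_triple;
    by rewrite ?invg_eq1 ?mulgV -?invMg ?mulVg.
apply: in_L_perm (in_L_cat (in_L_cat (in_L_atom (atom_inv_pair a1))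
  (in_L_atom (atom_inv_pair b1))) (in_L_atom (atom_inv_pair ab1))).
by perm_count.
Qed.

Lemma Delta_interval : 3 <= #|gT| -> propertyP gT ->
  exists b, 1 <= b /\ forall d, in_Delta gT d <-> 1 <= d <= b.
Proof.
move=> hG propP.
have [A A2 A3] := exists_lengths_2_3 hG.
have D1 : in_Delta gT 1.
  by apply: (@adjacent_lengths_in_Delta A 2 3); split=> // j; lia.
have [N bound] := Delta_bounded.
have [b bD bmax] := ex_max_nat D1 bound.
exists b; split=> [|d]; first exact: bmax.
split=> [dD|dP].
  rewrite bmax // andbT; case: dD => ? [_ [l [m [_ [_ [lt [-> _]]]]]]]; lia.
case: bD => C [_ [l [m [Cl [Cm [lt [bE no]]]]]]].
by apply: (@Delta_downward_closed C l m) => //; rewrite -bE.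
Qed.

End ProductOne.

Theorem theorem5p5 (gT : finGroupType) (hG : 3 <= #|gT|) :
  (forall k : nat, finite_interval (@in_Uk gT k)) /\
  (propertyP gT ->
     exists b : nat, 1 <= b /\ forall d : nat, @in_Delta gT d <-> 1 <= d <= b).
Proof.
split; first exact: in_Uk_finite_interval.
exact: Delta_interval.
Qed.
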